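(* Let $d\in\mathbb N$, $d\ge1$, and let $f\in{}^\rho\mathcal E(\mathbb R^d)$. If $f$ is invariant under standard translations, i.e., $f(x+h)=f(x)$ holds in ${}^\rho\mathcal E(\mathbb R^d)$ for all $h\in\mathbb R^d$, then $f$ is constant.
   Context: Work in a fixed nonstandard extension, with ${}^*$ the transfer map, and let $\rho\in{}^*\mathbb R$ be a fixed positive infinitesimal. For $x,y\in{}^*\mathbb C$, write $x\approxeq y$ iff $|x-y|\le\rho^n$ for all (standard) $n\in\mathbb N$. An element $x\in{}^*\mathbb C$ is moderate, written $x\in{}^*\mathbb C_M$, iff $|x|\le1/\rho^n$ for some (standard) $n\in\mathbb N$. $\mathrm{ns}({}^*\mathbb R^d)$ denotes the set of near-standard (= finite) elements of ${}^*\mathbb R^d$. ${}^*\mathcal C^\infty(\mathbb R^d)$ is the ${}^*$-transform of the space $\mathcal C^\infty(\mathbb R^d)$ of smooth functions $\mathbb R^d\to\mathbb C$ (its elements are internal functions ${}^*\mathbb R^d\to{}^*\mathbb C$). The algebra of nonstandard Colombeau generalized functions is ${}^\rho\mathcal E(\mathbb R^d)=\mathcal E_M(\mathbb R^d)/\mathcal N(\mathbb R^d)$, where $\mathcal E_M(\mathbb R^d)=\{u\in{}^*\mathcal C^\infty(\mathbb R^d):\ \partial^\alpha u(x)\in{}^*\mathbb C_M\ \ \forall x\in\mathrm{ns}({}^*\mathbb R^d),\ \forall\alpha\in\mathbb N^d\}$ and $\mathcal N(\mathbb R^d)=\{u\in{}^*\mathcal C^\infty(\mathbb R^d):\ \partial^\alpha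 u(x)\approxeq0\ \ \forall x\in\mathrm{ns}({}^*\mathbb R^d),\ \forall\alpha\in\mathbb N^d\}$. For $h\in\mathbb R^d$, $f(x+h)$ denotes the class of $x\mapsto\tilde f(x+h)$, where $\tilde f$ is a representative of $f$. $f$ is constant if it is the class of a constant function, i.e. $\tilde f-\tilde f(0)\in\mathcal N(\mathbb R^d)$ for a representative $\tilde f$ of $f$. *)

(* Defs.v *)
From HB Require Import structures.
From mathcomp Require Import all_boot all_order all_algebra.
From mathcomp Require Import complex.
From mathcomp Require Import all_classical all_reals all_analysis.

Set Implicit Arguments.
Unset Strict Implicit.
Unset Printing Implicit Defensive.

Import Order.TTheory GRing.Theory Num.Theory.
Import numFieldNormedType.Exports.

Local Open Scope classical_set_scope.
Local Open Scope ring_scope.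

(* Nonstandard extensions: a star map on sets, functions and relations that
   satisfies the transfer principle.  The sorts of the language are all types
   of a universe, in particular function spaces and power sets, and every
   function and every relation between sorts is a symbol.  A quantifier over
   the sort [A] is the bounded quantifier "for all x in A" of the
   superstructure language; in the nonstandard interpretation it ranges over
   the elements of *A.  The elements of *(A -> B) are the internal functions
   from *A to *B, applied through the extension [sapp] of evaluation. *)

(* tuples of elements of the sorts listed in [G], read through [I] *)
Fixpoint env (I : Type -> Type) (G : seq Type) : Type :=
  if G is A :: G' then (I A * env I G')%type else unit.

(* de Bruijn variables of sort [A] in context [G] *)
Inductive var : seq Type -> Type -> Type :=
| Vz G A : var (A :: G) A
| Vs G A B : var G A -> var (B :: G) A.

Fixpoint lookup (I : Type -> Type) G A (v : var G A) : env I G -> I A :=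
  match v in var G A return env I G -> I A with
  | Vz _ _ => fun e => e.1
  | Vs _ _ _ v' => fun e => lookup v' e.2
  end.

Fixpoint lookups (I : Type -> Type) G D :
    env (var G) D -> env I G -> env I D :=
  match D return env (var G) D -> env I G -> env I D with
  | [::] => fun _ _ => tt
  | A :: D' => fun vs e => (lookup vs.1 e, lookups vs.2 e)
  end.

Definition std (A : Type) : Type := A.

(* [FFun f xs y] is the atom y = f(xs), [FRel P xs] the atom P(xs). *)
Inductive formula : seq Type -> Type :=
| FRel G D (P : env std D -> Prop) (xs : env (var G) D) : formula G
| FFun G D B (f : env std D -> B) (xs : env (var G) D) (y : var G B) : formula G
| FEq G A (x y : var G A) : formula G
| FNot G : formula G -> formula G
| FAnd G : formula G -> formula G -> formula G
| FOr G : formula G -> formula G -> formula G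
| FImp G : formula G -> formula G -> formula G
| FAll G A : formula (A :: G) -> formula G
| FEx G A : formula (A :: G) -> formula G.

Record interpretation := Interpretation {
  dom :> Type -> Type;
  ifun : forall (D : seq Type) (B : Type),
    (env std D -> B) -> env dom D -> dom B;
  irel : forall D : seq Type, (env std D -> Prop) -> env dom D -> Prop
}.

Definition standard_interpretation : interpretation :=
  @Interpretation std (fun _ _ f => f) (fun _ P => P).

Fixpoint holds (M : interpretation) G (phi : formula G) : env M G -> Prop :=
  match phi in formula G return env M G -> Prop with
  | FRel _ _ P xs => fun e => irel P (lookups xs e)
  | FFun _ _ _ f xs y => fun e => lookup y e = ifun f (lookups xs e)
  | FEq _ _ x y => fun e => lookup x e = lookup y e
  | FNot _ p => fun e => ~ holds p e
  | FAnd _ p q => fun e => holds p e /\ holds q e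
  | FOr _ p q => fun e => holds p e \/ holds q e
  | FImp _ p q => fun e => holds p e -> holds q e
  | FAll _ A p => fun e => forall x : M A, holds (M := M) p (x, e)
  | FEx _ A p => fun e => exists x : M A, holds (M := M) p (x, e)
  end.

Record nonstandard_extension := NonstandardExtension {
  star :> interpretation;
  transfer : forall phi : formula [::],
    holds (M := standard_interpretation) phi tt <-> holds (M := star) phi tt
}.

Section StarMap.
Variable S : nonstandard_extension.

Definition starf1 A B (f : A -> B) (x : S A) : S B :=
  @ifun S [:: A] B (fun e => f e.1) (x, tt).

Definition starf2 A B C (f : A -> B -> C) (x : S A) (y : S B) : S C :=
  @ifun S [:: A; B] C (fun e => f e.1 e.2.1) (x, (y, tt)).

Definition starp1 A (P : A -> Prop) (x : S A) : Prop :=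
  @irel S [:: A] (fun e => P e.1) (x, tt).

Definition starp2 A B (P : A -> B -> Prop) (x : S A) (y : S B) : Prop :=
  @irel S [:: A; B] (fun e => P e.1 e.2.1) (x, (y, tt)).

(* the standard element *a of *A *)
Definition emb A (a : A) : S A := @ifun S [::] A (fun _ => a) tt.

(* value at [x] of the internal function [u] *)
Definition sapp A B (u : S (A -> B)) (x : S A) : S B :=
  starf2 (fun (f : A -> B) a => f a) u x.

End StarMap.

(* [Rcomplex R] is the field of complex numbers over [R] as a real vector
   space with the modulus as its ([R]-valued) norm; give it the topology of
   that norm. *)
HB.instance Definition _ (R : realType) :=
  PseudoMetric.copy (Rcomplex R) (pseudoMetric_normed (Rcomplex R)).
HB.instance Definition _ (R : realType) :=
  isPointed.Build (Rcomplex R) 0.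
HB.instance Definition _ (R : realType) :=
  NormedZmod_PseudoMetric_eq.Build R (Rcomplex R) erefl.

Lemma Rcomplex_normZ (R : realType) (l : R) (x : Rcomplex R) :
  `|l *: x| = `|l| * `|x|.
Proof.
case: x => a b.
rewrite /Num.norm /= /Normc.normc /= !exprMn -mulrDr sqrtrM ?sqr_ge0//.
by rewrite sqrtr_sqr.
Qed.

HB.instance Definition _ (R : realType) :=
  PseudoMetricNormedZmod_Lmodule_isNormedModule.Build R (Rcomplex R)
    (@Rcomplex_normZ R).

Section Smooth.
Variables (R : realType) (d : nat).

Definition partial (i : 'I_d) (f : 'rV[R]_d -> Rcomplex R) :
    'rV[R]_d -> Rcomplex R :=
  fun x => 'D_(delta_mx ord0 i) f x.

Definition pderiv (a : 'I_d -> nat) (f : 'rV[R]_d -> Rcomplex R) :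
    'rV[R]_d -> Rcomplex R :=
  foldr (fun i g => iter (a i) (partial i) g) f (enum 'I_d).

(* All iterated partial derivatives, in any order, exist and are continuous.
   Existence is stated separately because ['D_] is total. *)
Definition smooth (f : 'rV[R]_d -> Rcomplex R) : Prop :=
  forall s : seq 'I_d, let g := foldr partial f s in
    continuous g /\
    (forall i x, derivable g x (delta_mx ord0 i)).

End Smooth.

Section Colombeau.
Variables (S : nonstandard_extension) (R : realType) (rho : S R) (d : nat).

Let E : Type := 'rV[R]_d.
Let C : Type := Rcomplex R.

Definition positive_infinitesimal : Prop :=
  starp2 (fun x y : R => x < y) (emb S 0) rho /\
  (forall e : R, 0 < e -> starp2 (fun x y : R => x < y) rho (emb S e)).

Definition negligibly_close (x y : S C) : Prop :=
  forall n : nat,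
    starp2 (fun a b : R => a <= b)
      (starf2 (fun x y : C => `|x - y|) x y) (starf1 (fun r : R => r ^+ n) rho).

Definition moderate (x : S C) : Prop :=
  exists n : nat,
    starp2 (fun a b : R => a <= b)
      (starf1 (fun x : C => `|x|) x) (starf1 (fun r : R => 1 / r ^+ n) rho).

Definition near_standard (x : S E) : Prop :=
  exists a : E, forall e : R, 0 < e ->
    starp2 (fun x y : R => x < y)
      (starf2 (fun x y : E => `|x - y|) x (emb S a)) (emb S e).

Definition star_smooth : set (S (E -> C)) := starp1 (@smooth R d).

Definition EModerate : set (S (E -> C)) :=
  [set u | star_smooth u /\
    forall x a, near_standard x -> moderate (sapp (starf1 (pderiv a) u) x)].

Definition ENegligible : set (S (E -> C)) :=
  [set u | star_smooth u /\
    forall x a, near_standard x ->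
      negligibly_close (sapp (starf1 (pderiv a) u) x) (emb S 0)].

(* the internal function x |-> u(x) - v(x) *)
Definition sdiff (u v : S (E -> C)) : S (E -> C) :=
  starf2 (fun f g : E -> C => fun x => f x - g x) u v.

(* the class of [u] modulo [ENegligible] *)
Definition cls (u : S (E -> C)) : set (S (E -> C)) :=
  [set v | EModerate v /\ ENegligible (sdiff v u)].

(* the quotient algebra, as the set of cosets *)
Definition rhoE : set (set (S (E -> C))) := [set cls u | u in EModerate].

(* the internal function x |-> u(x + *h) *)
Definition sshift (h : E) (u : S (E -> C)) : S (E -> C) :=
  starf1 (fun (f : E -> C) x => f (x + h)) u.

(* f(x + h), the class of [sshift h u] for a representative [u] of [f].  This
   class does not depend on [u], since [sshift h] maps [ENegligible] into
   itself: the union below is a union of equal sets. *)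
Definition translate (h : E) (f : set (S (E -> C))) : set (S (E -> C)) :=
  \bigcup_(u in f) cls (sshift h u).

(* the internal constant function with value [c] *)
Definition sconst (c : S C) : S (E -> C) := starf1 (fun c (_ : E) => c) c.

Definition is_constant (f : set (S (E -> C))) : Prop :=
  exists2 u, f u & ENegligible (sdiff u (sconst (sapp u (emb S 0)))).

End Colombeau.

(* Main.v *)
Require Import Defs.
From mathcomp Require Import all_boot all_order all_algebra.
From mathcomp Require Import complex.
From mathcomp Require Import all_classical all_reals all_analysis.
From mathcomp Require Import ring lra.

Set Implicit Arguments.
Unset Strict Implicit.
Unset Printing Implicit Defensive.

Import Order.TTheory GRing.Theory Num.Theory.
Import numFieldNormedType.Exports.

Local Open Scope classical_set_scope.
Local Open Scope ring_scope.

(** Let [u] represent the given generalized function.  Its values along a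
    coordinate direction [e] are controlled by only two standard translations,
    by [K e] and by [lambda K e], where [lambda] is the golden section
    [(sqrt 5 - 1) / 2] and [K] is a standard bound for the points considered.
    Since [lambda^(j+2) = lambda^j - lambda^(j+1)], a translation by
    [lambda^(j+2) K e] is composed of two earlier ones.  So if the two
    generators change [u] by at most [delta] on a large ball, then translation
    by [lambda^j K e] changes it by at most [2^j delta]
    ([golden_translation]).  The greedy expansion in powers of [lambda] writes
    each [t] in [0, 1] as a sum of distinct powers up to an error [lambda^J],
    at total cost [2^(J+1) delta] ([golden_expansion]); the error is paid for
    by the mean value inequality.  With [lambda^J] of the order of [r], where
    [0 < r <= 1], this gives
      [|u(y + t K e) - u(y)| <= 4 delta / r^2 + 2 M K r]
    where [M] bounds the derivative of [u] in direction [e]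
    ([golden_estimate]).  Moderateness gives [M <= rho^(-m)] for some standard
    [m] and invariance gives [delta <= rho^N] for every standard [N]; the choice
    of [r = rho^k], first with [k] large and then with [N] large, makes the
    right-hand side smaller than [rho^n] for any prescribed [n]
    ([invariance_step]).  Going from [0] to [x] one coordinate at a time,
    [u(x) - u(0)] is negligible at each finite [x] ([negligible_increment]).

    The derivatives of [u - u(0)] are then negligible by induction on the
    order, from Landau's interpolation inequality
      [|w'| <= 2 sup |w| / r + 4 r sup |w''|]
    along a coordinate axis, where [w''] is moderate ([landau],
    [negligible_derivatives]).

    These arguments are about standard functions and reals.  They reach the
    internal ones by transfer, in the following form: for a fixed tuple [e] of
    internal objects, the standard predicates [P] such that [*P(e)] holds form
    an ultrafilter (the lemmas on [irel]), hence contain each standard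
    consequence of finitely many of them.  The bounds must be uniform over
    balls of standard radius.  For this, points of such balls are near-standard
    by compactness ([star_ball_near_standard]), and the modulus of a derivative
    attains its maximum at an internal point, whose exponent of moderateness
    serves the whole ball ([EModerate_uniform]). *)

(** * Transfer as an ultrafilter of standard predicates *)

Section Transfer.
Variable S : nonstandard_extension.

Let sholds := holds (M := standard_interpretation).

(** The free variables of a formula can be closed by universal quantifiers, one
    at a time, so transfer extends from sentences to open formulas. *)
Lemma transfer_open D (phi : formula D) :
  (forall e : env std D, sholds phi e) <->
  (forall e : env S D, holds (M := star S) phi e).
Proof.
elim: D phi => [|A D IH] phi.
  have [st ts] := transfer S phi.
  by split=> [h [] | h]; [apply: st; exact: h | case; apply: ts; exact: h].
by split=> h => [[x e]|[x e]];
  have /= [p q] := IH (FAll phi); [apply: p | apply: q] => {x} {}e x; exact: h.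
Qed.

Fixpoint vshift (A : Type) D D' : env (var D) D' -> env (var (A :: D)) D' :=
  match D' return env (var D) D' -> env (var (A :: D)) D' with
  | [::] => fun _ => tt
  | B :: D'' => fun vs => (Vs A vs.1, vshift A vs.2)
  end.

(** The tuple of all variables of a context, so that [FRel P (vars D)] says [P]
    of the whole environment. *)
Fixpoint vars D : env (var D) D :=
  match D return env (var D) D with
  | [::] => tt
  | A :: D' => (Vz D' A, vshift A (vars D'))
  end.

Lemma lookups_shift (I : Type -> Type) A D D' (vs : env (var D) D') (x : I A) e :
  lookups (I := I) (vshift A vs) (x, e) = lookups vs e.
Proof. by elim: D' vs => //= B D' IH vs; rewrite IH. Qed.

Lemma lookups_vars (I : Type -> Type) D (e : env I D) : lookups (vars D) e = e.
Proof. by elim: D e => [[]//|A D IH [x e]] /=; rewrite lookups_shift IH. Qed.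

Definition atom D (P : env std D -> Prop) : formula D := FRel P (vars D).

Lemma holds_atom D (P : env std D -> Prop) e :
  holds (M := star S) (atom P) e = irel P e.
Proof. by rewrite /= lookups_vars. Qed.

Lemma sholds_atom D (P : env std D -> Prop) : sholds (atom P) = P.
Proof. by apply/funext => e; rewrite /sholds /= lookups_vars. Qed.

(** Every formula is equivalent to the atom of the predicate that it defines.
    This equivalence is itself a formula, true in the standard interpretation.
    All rules below, through which [irel] commutes with the connectives, come
    from it. *)
Lemma irel_holds D (phi : formula D) (e : env S D) :
  irel (sholds phi) e = holds (M := star S) phi e.
Proof.
pose chi := FAnd (FImp (atom (sholds phi)) phi) (FImp phi (atom (sholds phi))).
have chiT e' : sholds chi e' by rewrite /sholds /= !lookups_vars.
have [/(_ chiT e) + _] := transfer_open chi.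
by rewrite /= lookups_vars => -[p q]; exact/propext.
Qed.

Lemma irel_true D (P : env std D -> Prop) (e : env S D) :
  (forall e, P e) -> irel P e.
Proof.
move=> h; rewrite -holds_atom; move: e; apply/transfer_open => e.
by rewrite sholds_atom.
Qed.

Lemma irel_not D (P : env std D -> Prop) (e : env S D) :
  irel (fun e => ~ P e) e = ~ irel P e.
Proof.
rewrite -(holds_atom P) -[RHS]/(holds (M := star S) (FNot (atom P)) e) -irel_holds.
by congr irel; apply/funext => e'; rewrite /sholds /= !lookups_vars.
Qed.

Lemma irel_and D (P Q : env std D -> Prop) (e : env S D) :
  irel (fun e => P e /\ Q e) e = (irel P e /\ irel Q e).
Proof.
rewrite -(holds_atom P) -(holds_atom Q).
rewrite -[RHS]/(holds (M := star S) (FAnd (atom P) (atom Q)) e) -irel_holds.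
by congr irel; apply/funext => e'; rewrite /sholds /= !lookups_vars.
Qed.

Lemma irel_imp D (P Q : env std D -> Prop) (e : env S D) :
  irel (fun e => P e -> Q e) e = (irel P e -> irel Q e).
Proof.
rewrite -(holds_atom P) -(holds_atom Q).
rewrite -[RHS]/(holds (M := star S) (FImp (atom P) (atom Q)) e) -irel_holds.
by congr irel; apply/funext => e'; rewrite /sholds /= !lookups_vars.
Qed.

Lemma irel_forall A D (P : env std (A :: D) -> Prop) (e : env S D) :
  irel (fun e => forall x : A, P (x, e)) e = forall x : S A, irel P (x, e).
Proof.
under [RHS]eq_forall => x do rewrite -(holds_atom P).
rewrite -[RHS]/(holds (M := star S) (FAll (atom P)) e) -irel_holds.
congr irel; apply/funext => e'; rewrite /sholds /=.
by apply: eq_forall => x; rewrite lookups_shift lookups_vars.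
Qed.

Lemma irel_exists A D (P : env std (A :: D) -> Prop) (e : env S D) :
  irel (fun e => exists x : A, P (x, e)) e = exists x : S A, irel P (x, e).
Proof.
under [RHS]eq_exists => x do rewrite -(holds_atom P).
rewrite -[RHS]/(holds (M := star S) (FEx (atom P)) e) -irel_holds.
congr irel; apply/funext => e'; rewrite /sholds /=.
by apply: eq_exists => x; rewrite lookups_shift lookups_vars.
Qed.

Lemma ifun_var0 A D (x : S A) (e : env S D) :
  ifun (fun e : env std (A :: D) => e.1) (x, e) = x.
Proof.
pose phi : formula (A :: D) :=
  FFun (fun e : env std (A :: D) => e.1) (vars (A :: D)) (Vz D A).
have h e' : sholds phi e' by [].
have [/(_ h (x, e)) + _] := transfer_open phi.
by rewrite /= lookups_shift lookups_vars.
Qed.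

Lemma ifun_varS A B D (f : env std D -> B) (x : S A) (e : env S D) :
  ifun (fun e : env std (A :: D) => f e.2) (x, e) = ifun f e.
Proof.
pose phi : formula (B :: A :: D) :=
  FImp (FFun f (vshift B (vshift A (vars D))) (Vz _ B))
   (FFun (fun e : env std (A :: D) => f e.2) (vshift B (vars (A :: D))) (Vz _ B)).
have h e' : sholds phi e'.
  by case: e' => y [z e']; rewrite /sholds /= !lookups_shift lookups_vars.
have [/(_ h (ifun f e, (x, e))) + _] := transfer_open phi.
by rewrite /= !lookups_shift lookups_vars => /(_ erefl).
Qed.

Lemma ifun_emb B D (b : B) (e : env S D) :
  emb S b = ifun (fun _ : env std D => b) e.
Proof.
elim: D e => [[]//|A D IH [x e]].
by rewrite (IH e) -(ifun_varS (fun=> b) x).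
Qed.

(** The extension of functions commutes with composition because the graph of
    a composite is definable from the graphs of its factors. *)
Lemma ifun_comp1 A B D (F : A -> B) (f : env std D -> A) (e : env S D) :
  starf1 F (ifun f e) = ifun (fun e => F (f e)) e.
Proof.
pose sh := vshift B (vshift A (vars D)).
pose v0 := Vz (A :: D) B; pose v1 := Vs B (Vz D A).
pose phi : formula (B :: A :: D) :=
  FImp (FFun f sh v1) (FImp
    (FFun (fun e : env std [:: A] => F e.1) ((v1, tt) : env (var _) [:: A]) v0)
    (FFun (fun e => F (f e)) sh v0)).
have h e' : sholds phi e'.
  by case: e' => y [z e']; rewrite /sholds /= !lookups_shift lookups_vars => -> ->.
have [/(_ h (starf1 F (ifun f e), (ifun f e, e))) + _] := transfer_open phi.
by rewrite /= !lookups_shift lookups_vars => /(_ erefl erefl).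
Qed.

Lemma ifun_comp2 A B C D (F : A -> B -> C) (f : env std D -> A)
    (g : env std D -> B) (e : env S D) :
  starf2 F (ifun f e) (ifun g e) = ifun (fun e => F (f e) (g e)) e.
Proof.
pose sh := vshift C (vshift A (vshift B (vars D))).
pose v0 := Vz [:: A, B & D] C; pose v1 := Vs C (Vz (B :: D) A).
pose v2 := Vs C (Vs A (Vz D B)).
pose phi : formula [:: C, A, B & D] :=
  FImp (FFun f sh v1) (FImp (FFun g sh v2) (FImp
    (FFun (fun e : env std [:: A; B] => F e.1 e.2.1)
      ((v1, (v2, tt)) : env (var _) [:: A; B]) v0)
    (FFun (fun e => F (f e) (g e)) sh v0))).
have h e' : sholds phi e'.
  case: e' => y [z [t e']]; rewrite /sholds /= !lookups_shift lookups_vars.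
  by move=> -> -> ->.
have [/(_ h (starf2 F (ifun f e) (ifun g e), (ifun f e, (ifun g e, e)))) + _] :=
  transfer_open phi.
by rewrite /= !lookups_shift lookups_vars => /(_ erefl erefl erefl).
Qed.

Lemma irel_comp1 A D (P : A -> Prop) (f : env std D -> A) (e : env S D) :
  starp1 P (ifun f e) = irel (fun e => P (f e)) e.
Proof.
pose sh := vshift A (vars D); pose v0 := Vz D A.
pose a := FRel (fun e : env std [:: A] => P e.1) ((v0, tt) : env (var _) [:: A]).
pose b := FRel (fun e => P (f e)) sh.
pose phi : formula (A :: D) := FImp (FFun f sh v0) (FAnd (FImp a b) (FImp b a)).
have h e' : sholds phi e'.
  by case: e' => y e'; rewrite /sholds /= !lookups_shift lookups_vars => ->.
have [/(_ h (ifun f e, e)) + _] := transfer_open phi.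
by rewrite /= !lookups_shift lookups_vars => /(_ erefl) [p q]; apply/propext.
Qed.

Lemma irel_comp2 A B D (P : A -> B -> Prop) (f : env std D -> A)
    (g : env std D -> B) (e : env S D) :
  starp2 P (ifun f e) (ifun g e) = irel (fun e => P (f e) (g e)) e.
Proof.
pose sh := vshift A (vshift B (vars D)).
pose v0 := Vz (B :: D) A; pose v1 := Vs A (Vz D B).
pose a := FRel (fun e : env std [:: A; B] => P e.1 e.2.1)
  ((v0, (v1, tt)) : env (var _) [:: A; B]).
pose b := FRel (fun e => P (f e) (g e)) sh.
pose phi : formula [:: A, B & D] :=
  FImp (FFun f sh v0) (FImp (FFun g sh v1) (FAnd (FImp a b) (FImp b a))).
have h e' : sholds phi e'.
  by case: e' => y [z e']; rewrite /sholds /= !lookups_shift lookups_vars => -> ->.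
have [/(_ h (ifun f e, (ifun g e, e))) + _] := transfer_open phi.
by rewrite /= !lookups_shift lookups_vars => /(_ erefl erefl) [p q]; apply/propext.
Qed.

Lemma irel_varS A D (P : env std D -> Prop) (x : S A) (e : env S D) :
  irel (fun e : env std (A :: D) => P e.2) (x, e) = irel P e.
Proof.
pose a := atom (fun e : env std (A :: D) => P e.2).
pose b := FRel P (vshift A (vars D)).
have h e' : sholds (FAnd (FImp a b) (FImp b a)) e'.
  by case: e' => y e'; rewrite /sholds /= !lookups_shift lookups_vars.
have [/(_ h (x, e)) + _] := transfer_open (FAnd (FImp a b) (FImp b a)).
by rewrite /= !lookups_shift lookups_vars => -[p q]; apply/propext.
Qed.

End Transfer.

Section Denotation.
Variable S : nonstandard_extension.

(** In an environment [e], a nonstandard term [x] built from entries of [e] and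
    star extensions of standard functions is the value at [e] of the extension
    of one standard function [f].  Instance search computes [f], and the lemmas
    [starp1E] and [starp2E] then turn a nonstandard atom into [irel] of a
    readable standard predicate. *)
Class denotes D (e : env S D) B (x : S B) (f : env std D -> B) : Prop :=
  Denotes : x = ifun f e.

#[global] Instance denotes_var0 A D (x : S A) (e : env S D) :
  denotes (D := A :: D) (x, e) x (fun e => e.1).
Proof. by rewrite /denotes ifun_var0. Qed.

#[global] Instance denotes_varS A B D (x : S A) (y : S B) (e : env S D) f :
  denotes e y f -> denotes (D := A :: D) (x, e) y (fun e => f e.2).
Proof. by rewrite /denotes ifun_varS. Qed.

#[global] Instance denotes_emb B D (b : B) (e : env S D) :
  denotes e (emb S b) (fun=> b).
Proof. exact: ifun_emb. Qed.

#[global] Instance denotes_starf1 A B D (F : A -> B) (x : S A) (e : env S D) f :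
  denotes e x f -> denotes e (starf1 F x) (fun e => F (f e)).
Proof. by rewrite /denotes => ->; exact: ifun_comp1. Qed.

#[global] Instance denotes_starf2 A B C D (F : A -> B -> C) (x : S A) (y : S B)
    (e : env S D) f g :
  denotes e x f -> denotes e y g ->
  denotes e (starf2 F x y) (fun e => F (f e) (g e)).
Proof. by rewrite /denotes => -> ->; exact: ifun_comp2. Qed.

#[global] Instance denotes_sapp A B D (u : S (A -> B)) (x : S A) (e : env S D) f g :
  denotes e u f -> denotes e x g -> denotes e (sapp u x) (fun e => f e (g e)).
Proof. exact: denotes_starf2. Qed.

Lemma starp1E A D (e : env S D) (P : A -> Prop) (x : S A) f :
  denotes e x f -> starp1 P x = irel (fun e => P (f e)) e.
Proof. by move=> ->; exact: irel_comp1. Qed.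

Lemma starp2E A B D (e : env S D) (P : A -> B -> Prop) (x : S A) (y : S B) f g :
  denotes e x f -> denotes e y g ->
  starp2 P x y = irel (fun e => P (f e) (g e)) e.
Proof. by move=> -> ->; exact: irel_comp2. Qed.

Lemma irel_False D (e : env S D) : ~ irel (fun=> False) e.
Proof. by rewrite -irel_not; apply: irel_true => ? []. Qed.

(** The rules by which proofs about standard objects reach internal ones: a
    standard implication carries over to [irel]. *)
Lemma irel_mono D (P Q : env std D -> Prop) (e : env S D) :
  (forall e, P e -> Q e) -> irel P e -> irel Q e.
Proof. by move=> h; rewrite -irel_imp; exact: irel_true. Qed.

Lemma irel_mono2 D (P1 P2 Q : env std D -> Prop) (e : env S D) :
  (forall e, P1 e -> P2 e -> Q e) -> irel P1 e -> irel P2 e -> irel Q e.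
Proof. by move=> h; rewrite -!irel_imp; exact: irel_true. Qed.

Lemma irel_mono3 D (P1 P2 P3 Q : env std D -> Prop) (e : env S D) :
  (forall e, P1 e -> P2 e -> P3 e -> Q e) ->
  irel P1 e -> irel P2 e -> irel P3 e -> irel Q e.
Proof. by move=> h; rewrite -!irel_imp; exact: irel_true. Qed.

Lemma irel_mono4 D (P1 P2 P3 P4 Q : env std D -> Prop) (e : env S D) :
  (forall e, P1 e -> P2 e -> P3 e -> P4 e -> Q e) ->
  irel P1 e -> irel P2 e -> irel P3 e -> irel P4 e -> irel Q e.
Proof. by move=> h; rewrite -!irel_imp; exact: irel_true. Qed.

End Denotation.

(** * Near-standard points are the points of standard balls *)

Lemma closed_ball_compact (R : realType) (d : nat) (K : R) :
  compact [set x : 'rV[R]_d | `|x| <= K].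
Proof.
apply: bounded_closed_compact.
  exists K; split; first exact: num_real.
  by move=> M KM x /= /le_trans; apply; exact: ltW.
apply: (@closed_comp _ _ (fun x : 'rV[R]_d => `|x|) [set y | y <= K]).
  by move=> x _; exact: norm_continuous.
exact: closed_le.
Qed.

Section NearStandard.
Variables (S : nonstandard_extension) (R : realType) (d : nat).
Let E : Type := 'rV[R]_d.

Definition star_ball (K : R) (x : S E) : Prop := starp1 (fun x : E => `|x| <= K) x.

(** The standard sets whose extension contains [x] form an ultrafilter; a cluster
    point of it in the compact ball is infinitely close to [x], since otherwise
    the complement of some neighbourhood would belong to the ultrafilter. *)
Lemma star_ball_near_standard K x : star_ball K x -> near_standard x.
Proof.
move=> xK; pose F : set_system E := [set P | starp1 P x].
have FF : ProperFilter F.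
  have FE P : F P = irel (fun e : env std [:: E] => P e.1) (x, tt).
    by rewrite /F /= (starp1E (e := (x, tt) : env S [:: E])).
  split.
    by rewrite FE; exact: irel_False.
  split; rewrite ?FE.
  - exact: irel_true.
  - by move=> P Q; rewrite !FE; apply: irel_mono2.
  - by move=> P Q PQ; rewrite !FE; apply: irel_mono => e'; exact: PQ.
have [a [_ aF]] := closed_ball_compact FF xK.
exists a => r r0.
have [//|nr] := pselect (starp2 (fun x y : R => x < y)
  (starf2 (fun x y : E => `|x - y|) x (emb S a)) (emb S r)).
exfalso.
have : F [set y | ~ `|y - a| < r].
  pose xe : env S [:: E] := (x, tt).
  move: nr; rewrite /F /= (starp2E (e := xe)) (starp1E (e := xe)).
  by rewrite -irel_not.
move=> /aF /(_ (nbhsx_ballx a r r0)) [y [/=]].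
by rewrite -ball_normE /= distrC.
Qed.

Lemma near_standard_star_ball x : near_standard x -> exists K, star_ball K x.
Proof.
move=> [a /(_ 1 ltr01) xa]; exists (`|a| + 1).
pose xe : env S [:: E] := (x, tt).
move: xa; rewrite (starp2E (e := xe)) /star_ball (starp1E (e := xe)).
apply: irel_mono => -[y []] /= ya.
rewrite -(subrK a y) addrC (le_trans (ler_normD _ _))// lerD2l; exact: ltW.
Qed.

End NearStandard.

(** * Mean value inequality for complex-valued functions *)

Section MeanValue.
Variable R : realType.

Lemma derivable_line (V W : normedModType R) (f : V -> W) (x v : V) (t : R) :
  derivable f (x + t *: v) v ->
  is_derive t 1 (fun s => f (x + s *: v)) ('D_v f (x + t *: v)).
Proof.
move=> df.
have E : (fun h : R => h^-1 *: (f (x + (h *: 1 + t) *: v) - f (x + t *: v))) =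
    (fun h : R => h^-1 *: (f (h *: v + (x + t *: v)) - f (x + t *: v))).
  by apply/funext => h; rewrite scalerDl addrCA /GRing.scale/= mulr1.
split; first by rewrite /derivable /= E.
by rewrite /derive /= E.
Qed.

(** Used for the real and imaginary parts, which reduce complex values to the
    real mean value theorem. *)
Lemma is_derive_functional (W : normedModType R) (L : W -> R) (f : R -> W)
    (t : R) (df : W) :
  {morph L : x y / x - y} -> (forall k x, L (k *: x) = k * L x) ->
  (forall x, `|L x| <= `|x|) ->
  is_derive t 1 f df -> is_derive t 1 (L \o f) (L df).
Proof.
move=> LB LZ L1 [fd <-].
have Lc : continuous L.
  move=> x; apply/cvgrPdist_lt => e e0.
  apply: filterS (nbhsx_ballx x e e0) => y; rewrite -ball_normE /= => xy.
  by rewrite -LB (le_lt_trans (L1 _)).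
have cL : (fun h : R => h^-1 *: ((L \o f) (h *: 1 + t) - (L \o f) t)) @ 0^' -->
    L ('D_1 f t).
  have -> : (fun h : R => h^-1 *: ((L \o f) (h *: 1 + t) - (L \o f) t)) =
      L \o (fun h : R => h^-1 *: (f (h *: 1 + t) - f t)).
    by apply/funext => h; rewrite /= LZ LB.
  by apply: continuous_cvg; [exact: Lc | exact: fd].
by split; [exact: cvgP cL | exact: cvg_lim cL].
Qed.

Lemma mean_value_real (f df : R -> R) (M r : R) : 0 <= r ->
  (forall t, 0 <= t <= r -> is_derive t 1 f (df t)) ->
  (forall t, 0 <= t <= r -> `|df t| <= M) -> `|f r - f 0| <= M * r.
Proof.
move=> r0 fd dM.
have [||c cr ->] := @MVT_segment R f df 0 r r0.
- move=> t; rewrite in_itv/= => /andP[t0 tr]; apply: fd; apply/andP; split; exact: ltW.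
- apply: derivable_within_continuous => t; rewrite in_itv/= => tr.
  by have [] := fd t tr.
- rewrite subr0 normrM (ger0_norm r0) ler_wpM2r// dM//.
Qed.

Lemma Rcomplex_Re_le (z : Rcomplex R) : `|complex.Re z| <= `|z|.
Proof.
case: z => a b; rewrite -sqrtr_sqr [leRHS]/Num.norm /= ler_wsqrtr//.
by rewrite lerDl sqr_ge0.
Qed.

Lemma Rcomplex_Im_le (z : Rcomplex R) : `|complex.Im z| <= `|z|.
Proof.
case: z => a b; rewrite -sqrtr_sqr [leRHS]/Num.norm /= ler_wsqrtr//.
by rewrite lerDr sqr_ge0.
Qed.

Lemma Rcomplex_norm_le (z : Rcomplex R) :
  `|z| <= `|complex.Re z| + `|complex.Im z|.
Proof.
case: z => a b; rewrite [leLHS]/Num.norm /=.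
rewrite -[leRHS]ger0_norm ?addr_ge0// -sqrtr_sqr ler_wsqrtr//.
rewrite sqrrD !real_normK ?num_real// -addrA lerD2l lerDr mulrn_wge0//.
Qed.

(** The factor 2 comes from bounding the modulus by the sum of the moduli of the
    real and imaginary parts. *)
Lemma mean_value (f df : R -> Rcomplex R) (M r : R) : 0 <= r ->
  (forall t, 0 <= t <= r -> is_derive t 1 f (df t)) ->
  (forall t, 0 <= t <= r -> `|df t| <= M) -> `|f r - f 0| <= M * r *+ 2.
Proof.
move=> r0 fd dM; apply: (le_trans (Rcomplex_norm_le _)).
pose re (z : Rcomplex R) := complex.Re z; pose im (z : Rcomplex R) := complex.Im z.
have reB : {morph re : x y / x - y} by case=> a b [a' b'].
have imB : {morph im : x y / x - y} by case=> a b [a' b'].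
rewrite -/(re _) -/(im _) reB imB mulr2n lerD//.
- apply: (@mean_value_real (re \o f) (re \o df)) => // t tr.
    apply: is_derive_functional => //; first by move=> k [].
      exact: Rcomplex_Re_le.
    exact: fd.
  exact: le_trans (Rcomplex_Re_le _) (dM _ tr).
- apply: (@mean_value_real (im \o f) (im \o df)) => // t tr.
    apply: is_derive_functional => //; first by move=> k [].
      exact: Rcomplex_Im_le.
    exact: fd.
  exact: le_trans (Rcomplex_Im_le _) (dM _ tr).
Qed.

End MeanValue.

(** * Translations by powers of the golden section *)

Section Golden.
Variable R : realType.

Definition golden : R := (Num.sqrt 5 - 1) / 2.

Lemma goldenXX : golden * golden = 1 - golden.
Proof.
have h5 : (Num.sqrt 5 : R) ^+ 2 = 5 by rewrite sqr_sqrtr.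
rewrite /golden; move: (Num.sqrt 5 : R) h5 => s h5.
have -> : (s - 1) / 2 * ((s - 1) / 2) = (s ^+ 2 - 2 * s + 1) / 4 by field.
by rewrite h5; field.
Qed.

Lemma golden_gt12 : 2^-1 < golden.
Proof.
rewrite /golden ltr_pdivlMr// mulVf// ltrBrDr.
rewrite -[ltLHS]ger0_norm// -sqrtr_sqr ltr_sqrt//.
by rewrite expr2; lra.
Qed.

Lemma golden_lt23 : golden < 2 / 3.
Proof.
have := goldenXX; have := golden_gt12; move: golden => l l2 ll.
rewrite ltNge; apply/negP => l3; nra.
Qed.

Lemma golden_gt0 : 0 < golden.
Proof. by apply: lt_trans golden_gt12. Qed.

Lemma golden_lt1 : golden < 1.
Proof. by have := golden_lt23; lra. Qed.

Lemma goldenSS j : golden ^+ j.+2 = golden ^+ j - golden ^+ j.+1.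
Proof. by rewrite !exprSr -mulrA goldenXX mulrBr mulr1. Qed.

(** A translation by [golden^(j+2) v] is a translation by [- golden^(j+1) v]
    followed by one by [golden^j v], so the bounds satisfy a Fibonacci-like
    recursion, dominated by [2^j].  The intermediate point may lie further from
    the origin by [golden^(j+1) |v|]; the summand [3 golden^j |v|] in the
    hypothesis on [y] keeps all of these displacements inside the ball, because
    [3 golden^2 + golden <= 3 golden]. *)
Lemma golden_translation (V : normedModType R) (W : normedZmodType R)
    (f : V -> W) (v : V) (B delta : R) :
  (forall y, `|y| <= B -> `|f (y + v) - f y| <= delta) ->
  (forall y, `|y| <= B -> `|f (y + golden *: v) - f y| <= delta) ->
  forall j y, `|y| + 3 * `|v| <= B + 3 * golden ^+ j * `|v| ->
  `|f (y + golden ^+ j *: v) - f y| <= 2 ^+ j * delta.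
Proof.
move=> f0 f1; have v0 := normr_ge0 v.
suff H j : (forall y, `|y| + 3 * `|v| <= B + 3 * golden ^+ j * `|v| ->
    `|f (y + golden ^+ j *: v) - f y| <= 2 ^+ j * delta) /\
  (forall y, `|y| + 3 * `|v| <= B + 3 * golden ^+ j.+1 * `|v| ->
    `|f (y + golden ^+ j.+1 *: v) - f y| <= 2 ^+ j.+1 * delta).
  by move=> j; have [] := H j.
elim: j => [|j [IH0 IH1]]; split.
- by move=> y; rewrite !expr0 scale1r mul1r mulr1 lerD2r; exact: f0.
- move=> y; rewrite !expr1 => yB.
  have yB' : `|y| <= B by have := golden_lt1; nra.
  have d0 : 0 <= delta := le_trans (normr_ge0 _) (f1 y yB').
  by apply: (le_trans (f1 y yB')); lra.
- exact: IH1.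
move=> y yB; set z := y - golden ^+ j.+1 *: v.
have g0 : 0 <= golden ^+ j.+1 * `|v|.
  by rewrite mulr_ge0// exprn_ge0// ltW// golden_gt0.
have zB : `|z| + 3 * `|v| <= B + 3 * golden ^+ j.+1 * `|v|.
  have : `|z| <= `|y| + golden ^+ j.+1 * `|v|.
    rewrite (le_trans (ler_normB _ _))// lerD2l normrZ ger0_norm//.
    by rewrite exprn_ge0// ltW// golden_gt0.
  move: yB; rewrite [golden ^+ j.+2]exprSr; have := golden_lt23; nra.
have gS : golden ^+ j.+1 <= golden ^+ j.
  by rewrite exprSr ler_piMr ?exprn_ge0// ltW// ?golden_gt0 ?golden_lt1.
have zB' : `|z| + 3 * `|v| <= B + 3 * golden ^+ j * `|v| by nra.
have E1 : y + golden ^+ j.+2 *: v = z + golden ^+ j *: v.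
  by rewrite goldenSS scalerBl /z addrAC addrA.
have E2 : z + golden ^+ j.+1 *: v = y by rewrite /z subrK.
have := IH1 _ zB; have := IH0 _ zB'; rewrite E2 -E1 => h0 h1.
have d0 : 0 <= 2 ^+ j * delta := le_trans (normr_ge0 _) h0.
rewrite -[X in `|X|](subrKA (f z)) (le_trans (ler_normD _ _))//.
move: h0 h1 d0; rewrite [`|f z - f y|]distrC !exprS -!mulrA.
move: (2 ^+ j * delta) => D h0 h1 d0; lra.
Qed.

(** Greedy expansion of [t]: the remainder after step [J] is at most [golden^J],
    and the power [golden^(J+1)] is subtracted from it when possible.  Either way
    the new remainder is at most [golden^(J+1)], as
    [golden^J - golden^(J+1) = golden^(J+2)]. *)
Lemma golden_expansion (V : normedModType R) (W : normedZmodType R)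
    (f : V -> W) (v : V) (B delta : R) (y : V) :
  (forall y, `|y| <= B -> `|f (y + v) - f y| <= delta) ->
  (forall y, `|y| <= B -> `|f (y + golden *: v) - f y| <= delta) ->
  `|y| + 4 * `|v| <= B -> forall (J : nat) (t : R), 0 <= t <= 1 ->
  exists s, [/\ 0 <= s <= t, t - s <= golden ^+ J &
    `|f (y + s *: v) - f y| <= 2 ^+ J.+1 * delta].
Proof.
move=> f0 f1 yB J t /andP[t0 t1]; have v0 := normr_ge0 v.
have d0 : 0 <= delta.
  by apply: le_trans (normr_ge0 _) (f0 y _); lra.
elim: J => [|J [s [/andP[s0 st] ts fs]]].
  exists 0; split; first by rewrite lexx.
    by rewrite subr0 expr0.
  by rewrite scale0r addr0 subrr normr0 mulr_ge0.
have D0 : 0 <= 2 ^+ J.+1 * delta by rewrite mulr_ge0// exprn_ge0.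
have [sm|lg] := leP (t - s) (golden ^+ J.+1).
  exists s; split=> //; first by rewrite s0.
  by rewrite exprS -mulrA; lra.
exists (s + golden ^+ J.+1); split.
- have : 0 <= golden ^+ J.+1 by rewrite exprn_ge0// ltW// golden_gt0.
  by move: lg; lra.
- have : golden ^+ J.+2 <= golden ^+ J.+1.
    by rewrite [leLHS]exprSr ler_piMr ?exprn_ge0// ltW// ?golden_gt0 ?golden_lt1.
  by rewrite goldenSS; move: ts; lra.
have dom : `|y + s *: v| + 3 * `|v| <= B + 3 * golden ^+ J.+1 * `|v|.
  have : 0 <= golden ^+ J.+1 * `|v|.
    by rewrite mulr_ge0// exprn_ge0// ltW// golden_gt0.
  have := ler_normD y (s *: v); rewrite normrZ (ger0_norm s0).
  nra.
have := golden_translation f0 f1 dom; rewrite -addrA -scalerDl => h.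
rewrite -[X in `|X|](subrKA (f (y + s *: v))) (le_trans (ler_normD _ _))//.
by rewrite [2 ^+ J.+2]exprS -mulrA; lra.
Qed.

(** [J] is the exponent with [golden^(J+1) < r <= golden^J]; the factor [2^J] of
    the error is polynomially bounded in [1 / r] because [2 golden^2 <= 1]. *)
Lemma golden_scale (r : R) : 0 < r <= 1 ->
  exists J, golden ^+ J.+1 <= r /\ 2 ^+ J * r ^+ 2 <= 1.
Proof.
move=> /andP[r0 r1].
have ex : exists n, golden ^+ n < r.
  have : (fun n => golden ^+ n) @ \oo --> (0 : R).
    by apply: cvg_expr; rewrite ger0_norm ?ltW// ?golden_gt0// golden_lt1.
  move=> /cvgrPdist_lt /(_ r r0) [n _ /(_ n (leqnn n))] /=.
  by rewrite sub0r normrN ger0_norm ?exprn_ge0 ?ltW ?golden_gt0//; exists n.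
case: (ex_minnP ex) => -[|J] hJ minJ.
  by move: hJ; rewrite expr0 ltNge r1.
exists J; split; first exact: ltW.
have rJ : r <= golden ^+ J.
  by rewrite leNgt; apply/negP => /minJ; rewrite ltnn.
have r2 : r ^+ 2 <= (golden ^+ 2) ^+ J.
  by rewrite -exprM mulnC exprM lerXn2r// nnegrE ?ltW// exprn_gt0 ?golden_gt0.
apply: (le_trans (ler_wpM2l (exprn_ge0 _ _) r2)) => //.
have g2 : 0 <= 2 * golden ^+ 2 <= 1.
  by rewrite expr2 goldenXX; have := golden_gt12; have := golden_lt23; lra.
by have [g0 g1] := andP g2; rewrite -exprMn exprn_ile1.
Qed.

(** The expansion of [t / K] reaches a point within [golden^(J+1) K <= K r] of
    [y + t e], at a cost of [2^(J+2) delta <= 4 delta / r^2]; the mean value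
    inequality covers the rest. *)
Lemma golden_estimate (V : normedModType R) (f : V -> Rcomplex R) (e : V)
    (K B delta M r t : R) (y : V) :
  `|e| <= 1 -> 0 < K ->
  (forall y, derivable f y e) ->
  (forall y, `|y| <= B -> `|f (y + K *: e) - f y| <= delta) ->
  (forall y, `|y| <= B -> `|f (y + (golden * K) *: e) - f y| <= delta) ->
  (forall y, `|y| <= B -> `|'D_e f y| <= M) ->
  `|y| + 4 * K <= B -> 0 < r <= 1 -> 0 <= t <= K ->
  `|f (y + t *: e) - f y| <= 4 * delta / r ^+ 2 + 2 * M * K * r.
Proof.
move=> e1 K0 fd f0 f1 fM yB r01 /andP[t0 tK].
have [r0 r1] := andP r01.
have [J [gJ Jr]] := golden_scale r01.
pose v := K *: e.
have vK : `|v| <= K by rewrite normrZ gtr0_norm// ler_piMr// ltW.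
have f1' : forall y, `|y| <= B -> `|f (y + golden *: v) - f y| <= delta.
  by move=> z /f1; rewrite scalerA.
have yB' : `|y| + 4 * `|v| <= B by lra.
have d0 : 0 <= delta by apply: le_trans (normr_ge0 _) (f0 y _); lra.
have M0 : 0 <= M by apply: le_trans (normr_ge0 _) (fM y _); lra.
have tK1 : 0 <= t / K <= 1.
  by rewrite ler_pdivrMr// mul1r tK divr_ge0// ltW.
have [s [/andP[s0 st] ts fs]] := golden_expansion f0 f1' yB' J.+1 tK1.
have sKt : s * K <= t by rewrite -ler_pdivlMr.
have tsK : t - s * K <= golden ^+ J.+1 * K.
  by rewrite -ler_pdivrMr// mulrBl mulfK ?gt_eqF.
have step : `|f (y + t *: e) - f (y + s *: v)| <= M * (t - s * K) *+ 2.
  have := @mean_value R (fun tau => f ((y + s *: v) + tau *: e))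
    (fun tau => 'D_e f ((y + s *: v) + tau *: e)) M (t - s * K).
  rewrite scale0r addr0 -addrA {1}/v scalerA -scalerDl (addrC (s * K)) subrK.
  apply; first by rewrite subr_ge0.
    by move=> tau _; exact: derivable_line.
  move=> tau /andP[tau0 taut]; apply: fM.
  rewrite ?/v ?scalerA -addrA -scalerDl (le_trans (ler_normD _ _))// normrZ.
  have sK0 : 0 <= s * K by rewrite mulr_ge0// ltW.
  rewrite ger0_norm ?addr_ge0//.
  have : (s * K + tau) * `|e| <= K by rewrite -[leRHS]mulr1 ler_pM ?addr_ge0//; lra.
  lra.
rewrite -[X in `|X|](subrKA (f (y + s *: v))) (le_trans (ler_normD _ _))//.
rewrite addrC lerD//.
  apply: (le_trans fs); rewrite ler_pdivlMr ?exprn_gt0//.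
  have -> : 2 ^+ J.+2 = 4 * 2 ^+ J :> R by rewrite !exprS mulrA -natrM.
  have : 2 ^+ J * r ^+ 2 * delta <= delta by rewrite ler_piMl.
  by lra.
apply: (le_trans step).
rewrite -mulr_natl -!mulrA ler_wpM2l// ler_wpM2l//.
by apply: (le_trans tsK); rewrite mulrC ler_wpM2l// ltW.
Qed.

End Golden.

(** * Estimates in powers of a small parameter *)

Section Estimates.
Variable R : realType.

Lemma norm_unit_le1 d (i : 'I_d) : `|delta_mx ord0 i : 'rV[R]_d| <= 1.
Proof.
rewrite [leLHS]/Num.norm /= mx_normrE.
apply/bigmax_leP; split=> // -[a b] _ /=.
by rewrite mxE; case: andP => _; rewrite ?normr1 ?normr0.
Qed.

Lemma coord_le_norm d (x : 'rV[R]_d) (j : 'I_d) : `|x ord0 j| <= `|x|.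
Proof.
rewrite [leRHS]/Num.norm /= mx_normrE.
by apply/bigmax_geP; right; exists (ord0, j).
Qed.

Lemma small_power (c rho : R) (n : nat) :
  0 < rho -> c * rho <= 1 -> c * rho ^+ n.+1 <= rho ^+ n.
Proof.
move=> rho0 crho; rewrite exprS mulrA ler_piMl// exprn_ge0// ltW//.
Qed.

(** [golden_estimate] with [r = rho^k]: the derivative contributes
    [2 K rho^(k - m)] and the translations [4 rho^(N - 2 k)], and [k] and [N] are
    such that both exponents are [n + 1].  The factor [rho] that is left over
    absorbs the constants. *)
Lemma invariance_step (V : normedModType R) (K rho : R) (n m : nat)
    (f : V -> Rcomplex R) (e : V) :
  let k := (m + n).+1 in let N := (k * 2 + n).+1 in
  0 < K -> 0 < rho -> rho <= 1 -> (4 + 2 * K) * rho <= 1 -> `|e| <= 1 ->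
  (forall y, derivable f y e) ->
  (forall y, `|y| <= 5 * K -> `|f (y + K *: e) - f y| <= rho ^+ N) ->
  (forall y, `|y| <= 5 * K -> `|f (y + (golden R * K) *: e) - f y| <= rho ^+ N) ->
  (forall y, `|y| <= 5 * K -> `|'D_e f y| <= 1 / rho ^+ m) ->
  forall y t, `|y| <= K -> `|y + t *: e| <= K -> `|t| <= K ->
  `|f (y + t *: e) - f y| <= rho ^+ n.
Proof.
move=> k N K0 rho0 rho1 Krho e1 fd f0 f1 fM.
(* A step backwards from [y] is a forward step from its end point. *)
suff H y t : `|y| <= K -> 0 <= t <= K -> `|f (y + t *: e) - f y| <= rho ^+ n.
  move=> y t yK yteK tK; have [t0|t0] := leP 0 t.
    by apply: H => //; rewrite t0 -(ger0_norm t0).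
  have := H (y + t *: e) (- t) yteK.
  rewrite -addrA -scalerDl subrr scale0r addr0 distrC; apply.
  by rewrite oppr_ge0 ltW//= -ltr0_norm.
move=> yK tK.
have r01 : 0 < rho ^+ k <= 1 by rewrite exprn_gt0//= exprn_ile1// ltW.
have dom : `|y| + 4 * K <= 5 * K by lra.
apply: le_trans (golden_estimate e1 K0 fd f0 f1 fM dom r01 tK) _.
apply: le_trans (small_power n rho0 Krho).
have p0 j : rho ^+ j != 0 by rewrite expf_neq0// gt_eqF.
have -> : 4 * rho ^+ N / (rho ^+ k) ^+ 2 = 4 * rho ^+ n.+1.
  rewrite /N -addnS exprD exprM; field; exact: p0.
have -> : 2 * (1 / rho ^+ m) * K * rho ^+ k = 2 * K * rho ^+ n.+1.
  rewrite /k -addnS exprD; field; exact: p0.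
by rewrite [leRHS]mulrDl.
Qed.

(** Landau's inequality with step [r = rho^k]: the function
    [t |-> w(x + t e) - t w'(x)] has derivative at most [2 M r] on [0, r], so the
    mean value inequality bounds [r |w'(x)|] by [2 rho^N + 4 M r^2].  The
    exponents [k] and [N] make this at most [6 r rho^(n+1)]. *)
Lemma landau (V : normedModType R) (K rho : R) (n m : nat)
    (w : V -> Rcomplex R) (e : V) :
  let k := (m + n).+1 in let N := (k + n).+1 in
  0 < rho -> rho <= 1 -> 6 * rho <= 1 -> `|e| <= 1 ->
  (forall y, derivable w y e) -> (forall y, derivable (fun x => 'D_e w x) y e) ->
  (forall y, `|y| <= K + 1 -> `|w y| <= rho ^+ N) ->
  (forall y, `|y| <= K + 1 -> `|'D_e (fun x => 'D_e w x) y| <= 1 / rho ^+ m) ->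
  forall x, `|x| <= K -> `|'D_e w x| <= rho ^+ n.
Proof.
move=> k N rho0 rho1 rho6 e1 dw ddw wN wM x xK.
pose r := rho ^+ k; pose M := 1 / rho ^+ m; pose D := 'D_e w x.
have r0 : 0 < r by rewrite exprn_gt0.
have r1 : r <= 1 by rewrite exprn_ile1// ltW.
have M0 : 0 <= M by rewrite divr_ge0// exprn_ge0// ltW.
have line t : 0 <= t <= r -> `|x + t *: e| <= K + 1.
  move=> /andP[t0 tr]; rewrite (le_trans (ler_normD _ _))// lerD// normrZ.
  rewrite ger0_norm// -[leRHS]mulr1 ler_pM//; lra.
have dist t : 0 <= t <= r -> `|'D_e w (x + t *: e) - D| <= M * r *+ 2.
  move=> /andP[t0 tr].
  have := @mean_value R (fun s => 'D_e w (x + s *: e))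
    (fun s => 'D_e (fun x => 'D_e w x) (x + s *: e)) M t t0.
  rewrite scale0r addr0 => H; apply: (le_trans (H _ _)).
  - move=> s _; exact: (@derivable_line _ _ _ (fun x => 'D_e w x)).
  - by move=> s /andP[s0 st]; apply/wM/line; rewrite s0 (le_trans st).
  by rewrite lerMn2r ler_wpM2l.
have := @mean_value R (fun t => w (x + t *: e) - t *: D)
  (fun t => 'D_e w (x + t *: e) - D) (M * r *+ 2) r (ltW r0).
rewrite !scale0r addr0 subr0 => H.
have {}H : `|w (x + r *: e) - r *: D - w x| <= M * r *+ 2 * r *+ 2.
  apply: H => // t _.
  apply: is_deriveB; first exact: derivable_line.
  have := @derivable_line R _ _ (@id (Rcomplex R)) 0 D t (@derivable_id _ _ _ _).
  by rewrite derive_id; under eq_fun do rewrite add0r.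
have : r * `|D| <= rho ^+ N *+ 2 + M * r *+ 2 * r *+ 2.
  have -> : r * `|D| = `|(w (x + r *: e) - w x) - (w (x + r *: e) - r *: D - w x)|.
    rewrite -(ger0_norm (ltW r0)) -normrZ (ger0_norm (ltW r0)); congr (`|_|).
    by rewrite [_ - _ - w x]addrAC subKr.
  rewrite (le_trans (ler_normB _ _))// lerD//.
  rewrite (le_trans (ler_normB _ _))// mulr2n lerD// wN//; last by lra.
  by apply: line; rewrite ltW//=.
have p0 j : rho ^+ j != 0 by rewrite expf_neq0// gt_eqF.
have -> : rho ^+ N *+ 2 + M * r *+ 2 * r *+ 2 = r * (6 * rho ^+ n.+1).
  have -> : M * r = rho ^+ n.+1.
    by rewrite /M /r /k -addnS exprD; field; exact: p0.
  by rewrite /N -addnS exprD -/r; ring.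
rewrite ler_pM2l// => /le_trans; apply; exact: small_power.
Qed.

End Estimates.

(** * Iterated partial derivatives *)

Lemma continuous_subr_cst (R : realType) (V W : normedModType R) (f : V -> W) (c : W) :
  continuous f -> continuous (fun x => f x - c).
Proof. by move=> fc x; apply: cvgB; [exact: fc | exact: cvg_cst]. Qed.

Lemma continuous_normr (R : realType) (V W : normedModType R) (f : V -> W) :
  continuous f -> continuous (fun x => `|f x|).
Proof. by move=> fc x; apply: cvg_norm; exact: fc. Qed.

Section SmoothFunctions.
Variables (R : realType) (d : nat).
Local Notation E := 'rV[R]_d.
Local Notation C := (Rcomplex R).

(** The variables of differentiation in [pderiv a], outermost first: each [i]
    repeated [a i] times, in increasing order. *)
Definition word_on (r : seq 'I_d) (a : 'I_d -> nat) : seq 'I_d :=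
  flatten [seq nseq (a i) i | i <- r].

Definition word (a : 'I_d -> nat) : seq 'I_d := word_on (enum 'I_d) a.

Lemma pderivE a (f : E -> C) : pderiv a f = foldr (@partial R d) f (word a).
Proof.
rewrite /pderiv /word; elim: (enum 'I_d) => //= i r ->.
by rewrite /word_on /= foldr_cat; elim: (a i) => //= n ->.
Qed.

(** The [i] of the conclusion is the first letter: changing its exponent changes
    only the length of the initial block. *)
Lemma word_on_split (r : seq 'I_d) (a : 'I_d -> nat) : uniq r ->
  word_on r a = [::] \/
  exists i s, (0 < a i)%N /\ forall n : nat,
    word_on r (fun j => if j == i then n else a j) = nseq n i ++ s.
Proof.
elim: r => [|i r IH] /=; first by left.
move=> /andP[ir ur].
have [ai0|ai0] := posnP (a i).
  have [r0|[j [s [aj h]]]] := IH ur.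
    by left; rewrite /word_on /= ai0.
  right; exists j, s; split=> // n.
  rewrite -h /word_on /= ; case: eqVneq => [ij|_]; last by rewrite ai0.
  by move: aj; rewrite -ij ai0.
right; exists i, (word_on r a); split=> // n.
rewrite /word_on /= eqxx; congr (_ ++ flatten _); apply/eq_in_map => j jr.
by case: eqVneq => // ji; move: ir; rewrite -ji jr.
Qed.

(** Removing or doubling the first letter of a word gives again the word of a
    multi-index.  So [pderiv a] is a first derivative of some [pderiv a'], and its
    further derivative in the same direction is some [pderiv a''], without any
    exchange of partial derivatives. *)
Lemma word_cons (a : 'I_d -> nat) : word a != [::] ->
  exists i s, [/\ word a = i :: s, exists a', word a' = s &
    exists a', word a' = [:: i, i & s]].
Proof.
have [w0|[i [s [ai h]]]] := word_on_split a (enum_uniq 'I_d).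
  by rewrite /word w0.
move=> _.
have aE : word a = nseq (a i) i ++ s.
  rewrite -h; congr word_on; apply/funext => j.
  by case: eqVneq => // ->.
exists i, (nseq (a i).-1 i ++ s); split.
- by rewrite aE; case: (a i) ai.
- by exists (fun j => if j == i then (a i).-1 else a j); exact: h.
exists (fun j => if j == i then (a i).+1 else a j); rewrite [LHS]h.
by case: (a i) ai.
Qed.

Lemma word_unit (i : 'I_d) : word (fun j => j == i) = [:: i].
Proof.
have filterE r : word_on r (fun j => j == i) = seq.filter (pred1 i) r.
  by elim: r => //= j r IH; rewrite /word_on /= -/(word_on r _) IH; case: eqP.
by rewrite /word filterE filter_pred1_uniq ?enum_uniq ?mem_enum.
Qed.

Lemma partial_subr_cst (i : 'I_d) (f : E -> C) (c : C) :
  partial i (fun x => f x - c) = partial i f.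
Proof.
apply/funext => x; rewrite /partial /derive.
have subK h : f (h + x) - c - (f x - c) = f (h + x) - f x.
  by rewrite opprB addrA subrK.
by under eq_fun do rewrite /= subK.
Qed.

Lemma pderiv_subr_cst a (f : E -> C) (c : C) :
  word a != [::] -> pderiv a (fun x => f x - c) = pderiv a f.
Proof.
rewrite !pderivE; elim/last_ind: (word a) => //= s i _ _.
by rewrite !foldr_rcons partial_subr_cst.
Qed.

Lemma smooth_subr_cst (f : E -> C) (c : C) :
  smooth f -> smooth (fun x => f x - c).
Proof.
move=> fs s; elim/last_ind: s => [|s i _].
  have [/= fc fd] := fs [::]; split.
    exact: (@continuous_subr_cst R 'rV[R]_d (Rcomplex R)).
  by move=> i x; apply: derivableB; [exact: fd | exact: derivable_cst].
have := fs (rcons s i); rewrite !foldr_rcons.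
by rewrite partial_subr_cst.
Qed.

Lemma partial_cst0 (i : 'I_d) : partial i (fun _ : E => 0 : C) = fun=> 0.
Proof. by apply/funext => x; rewrite /partial derive_cst. Qed.

Lemma foldr_partial_cst0 (s : seq 'I_d) :
  foldr (@partial R d) (fun _ : E => 0 : C) s = fun=> 0.
Proof. by elim: s => //= i s ->; exact: partial_cst0. Qed.

Lemma smooth_cst0 : smooth (fun _ : E => 0 : C).
Proof.
move=> s /=; rewrite foldr_partial_cst0; split; first exact: cst_continuous.
by move=> i x; exact: derivable_cst.
Qed.

Lemma pderiv_max a (f : E -> C) (K : R) : 0 <= K -> smooth f ->
  exists x0, `|x0| <= K /\ forall x, `|x| <= K -> `|pderiv a f x| <= `|pderiv a f x0|.
Proof.
move=> K0 fs.
have fc : continuous (pderiv a f) by rewrite pderivE; have [] := fs (word a).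
have [||c cK cm] := @compact_EVT_max _ R (fun x : 'rV[R]_d => `|pderiv a f x|)
  [set x | `|x| <= K] _ (@closed_ball_compact R d K).
- by exists 0; rewrite /= normr0.
- exact/continuous_subspaceT/(@continuous_normr R 'rV[R]_d (Rcomplex R)).
exists c; split; first by rewrite inE in cK.
by move=> x xK; apply: cm; rewrite inE.
Qed.

End SmoothFunctions.

(** * Invariance under translations implies constancy *)

Section Constancy.
Variables (S : nonstandard_extension) (R : realType) (rho : S R) (d : nat).
Local Notation E := 'rV[R]_d.
Local Notation C := (Rcomplex R).
Local Notation ctx := [:: (E -> C : Type); (R : Type)].
Hypothesis hrho : positive_infinitesimal rho.

Definition holds_at (u : S (E -> C)) (P : (E -> C) -> R -> Prop) : Prop :=
  irel (D := ctx) (fun e => P e.1 e.2.1) (u, (rho, tt)).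

(** Uniformity over balls of standard radius replaces the quantifier over
    near-standard points, so that each bound is one standard predicate of [u] and
    [rho]. *)
Definition negligible_op (F : (E -> C) -> E -> C) (u : S (E -> C)) : Prop :=
  forall (K : R) n,
    holds_at u (fun f r => forall x, `|x| <= K -> `|F f x| <= r ^+ n).

Definition moderate_op (F : (E -> C) -> E -> C) (u : S (E -> C)) : Prop :=
  forall K : R, exists m,
    holds_at u (fun f r => forall x, `|x| <= K -> `|F f x| <= 1 / r ^+ m).

Lemma irel_ball D (K : R) (P : env std ((E : Type) :: D) -> Prop) (e : env S D) :
  irel (fun e => forall x : E, `|x| <= K -> P (x, e)) e =
  forall x : S E, star_ball K x -> irel P (x, e).
Proof.
rewrite (irel_forall (fun e' => `|e'.1| <= K -> P e')).
apply: eq_forall => x.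
rewrite (irel_imp (fun e' : env std ((E : Type) :: D) => `|e'.1| <= K)).
by rewrite /star_ball (starp1E (e := (x, e) : env S ((E : Type) :: D))).
Qed.

Lemma rho_small u (c : R) : 0 < c -> holds_at u (fun _ r => 0 < r <= c).
Proof.
move=> c0; have [r0 /(_ _ c0) rc] := hrho.
move: r0 rc; rewrite !(starp2E (e := (u, (rho, tt)) : env S ctx)).
by apply: irel_mono2 => e /= -> /= /ltW.
Qed.

Lemma negligibly_closeE D (e : env S D) (x y : S C) f g r n :
  denotes e x f -> denotes e y g -> denotes e rho r ->
  starp2 (fun a b : R => a <= b)
      (starf2 (fun x y : C => `|x - y|) x y) (starf1 (fun r : R => r ^+ n) rho) =
  irel (fun e => `|f e - g e| <= r e ^+ n) e.
Proof.
move=> hx hy hr.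
exact: starp2E (denotes_starf2 _ hx hy) (denotes_starf1 _ hr).
Qed.

Lemma pderiv0 (f : E -> C) : pderiv (fun=> 0%N) f = f.
Proof. by rewrite pderivE /word /word_on; elim: (enum 'I_d) => //. Qed.

(** Applied at the internal point where the modulus attains its maximum on the
    ball, moderateness gives an exponent valid for the whole ball. *)
Lemma EModerate_uniform u a : EModerate rho u -> moderate_op (pderiv a) u.
Proof.
move=> [us um] K; have [K0|K0] := leP 0 K; last first.
  exists 0%N; apply: irel_true => e x xK.
  by have := le_lt_trans xK K0; rewrite ltNge normr_ge0.
move: us; rewrite /star_smooth (starp1E (e := (u, (rho, tt)) : env S ctx)).
move=> us; have := irel_mono (fun e : env std ctx => @pderiv_max _ _ a e.1 K K0) us.
rewrite (irel_exists (fun e : env std ((E : Type) :: ctx) =>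
  `|e.1| <= K /\ forall x, `|x| <= K -> `|pderiv a e.2.1 x| <= `|pderiv a e.2.1 e.1|)).
move=> [x0]; rewrite irel_and => -[x0K x0max].
have [|m] := um x0 a.
  apply: (@star_ball_near_standard _ _ _ K).
  rewrite /star_ball.
  by rewrite (starp1E (e := (x0, (u, (rho, tt))) : env S ((E : Type) :: ctx))).
rewrite (starp2E (e := (x0, (u, (rho, tt))) : env S ((E : Type) :: ctx))) => xm.
exists m; rewrite /holds_at -(irel_varS _ x0).
move: x0max xm; apply: irel_mono2 => -[y [f [r []]]] /= ymax yr x xK.
exact: le_trans (ymax _ xK) yr.
Qed.

(** By invariance [u] lies in the class of a translate of some representative
    [v], and [v] differs from [u] by a negligible function, so that
    [u(x)], [v(x + h)] and [u(x + h)] are negligibly close to each other. *)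
Lemma invariant_negligible u (f : set (S (E -> C))) :
  f u -> f = cls rho u ->
  (forall h, translate rho h f = f) ->
  forall h, negligible_op (fun f x => f (x + h) - f x) u.
Proof.
move=> fu fE hinv h K n.
have : translate rho h f u by rewrite hinv.
move=> [v fv [_ [_ uv]]].
have [_ [_ vu]] : cls rho u v by rewrite -fE.
rewrite /holds_at (irel_ball _ (fun e : env std ((E : Type) :: ctx) =>
  `|e.2.1 (e.1 + h) - e.2.1 e.1| <= e.2.2.1 ^+ n)) => x xK.
pose xh := starf1 (fun y : E => y + h) x.
have xhns : near_standard xh.
  apply: (@star_ball_near_standard _ _ _ (K + `|h|)).
  move: xK; rewrite /star_ball /xh !(starp1E (e := (x, tt) : env S [:: (E : Type)])).
  by apply: irel_mono => -[y []] /= yK; rewrite (le_trans (ler_normD _ _))// lerD2r.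
have xns := star_ball_near_standard xK.
pose e := (v, (x, (u, (rho, tt)))) : env S [:: (E -> C : Type), (E : Type) & ctx].
have := uv x (fun=> 0%N) xns n.+1.
rewrite /sdiff /sshift (negligibly_closeE (e := e)) => h1.
have := vu xh (fun=> 0%N) xhns n.+1.
rewrite /xh /sdiff /sshift (negligibly_closeE (e := e)) => h2.
(* Exponent [n + 1] for both distances: the spare factor [rho <= 1 / 2] absorbs
   their number. *)
have i2 : 0 < 2^-1 :> R by rewrite invr_gt0.
have := rho_small u i2; rewrite /holds_at -(irel_varS _ x) -(irel_varS _ v) => h3.
rewrite -(irel_varS _ v); move: h1 h2 h3.
apply: irel_mono3 => -[g [y [f' [r []]]]] /=.
rewrite !pderiv0 !subr0 => h1 h2 /andP[r0 r2].
apply: le_trans (small_power n r0 (c := 2) _); last by lra.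
rewrite -[X in `|X|](subrKA (g (y + h))) (le_trans (ler_normD _ _))//.
by rewrite mulr_natl mulr2n lerD// distrC.
Qed.

(** The points [z k x], which keep the first [k] coordinates of [x] and vanish in
    the others, lead from [0] to [x] by [d] moves parallel to the axes; each move
    is an [invariance_step]. *)
Lemma negligible_increment u : EModerate rho u ->
  (forall h, negligible_op (fun f x => f (x + h) - f x) u) ->
  negligible_op (fun f x => f x - f 0) u.
Proof.
move=> um inv K n.
wlog K0 : K / 0 < K.
  move=> /(_ (Num.max K 1)); rewrite lt_max ltr01 orbT => /(_ isT).
  by apply: irel_mono => e H x xK; apply: H; rewrite le_max xK.
have step (i : 'I_d) n' : holds_at u (fun f r => forall y t, `|y| <= K ->
    `|y + t *: delta_mx ord0 i| <= K -> `|t| <= K ->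
    `|f (y + t *: delta_mx ord0 i) - f y| <= r ^+ n').
  have [m um'] := EModerate_uniform (fun j => j == i) um (5 * K).
  (* [m] must be known before the exponent of the translation error is chosen:
     the latter grows with [m]. *)
  have f0 := inv (K *: delta_mx ord0 i) (5 * K) ((m + n').+1 * 2 + n').+1.
  have f1 := inv ((golden R * K) *: delta_mx ord0 i) (5 * K)
    ((m + n').+1 * 2 + n').+1.
  have c0 : 0 < (4 + 2 * K)^-1 by rewrite invr_gt0 addr_gt0// mulr_gt0.
  have := rho_small u c0; have := proj1 um.
  rewrite /star_smooth (starp1E (e := (u, (rho, tt)) : env S ctx)) => us rs.
  have {}rs := irel_mono2 (Q := fun e : env std ctx => smooth e.1 /\
     0 < e.2.1 <= (4 + 2 * K)^-1) (fun e a b => conj a b) us rs.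
  move: um' f0 f1 rs; apply: irel_mono4 => -[f [r []]] /= fM f0 f1.
  move=> [fs /andP[r0 rK]].
  have rK' : (4 + 2 * K) * r <= 1.
    by rewrite mulrC -ler_pdivlMr ?mul1r// addr_gt0// mulr_gt0.
  apply: (@invariance_step R 'rV[R]_d K r n' m f (delta_mx ord0 i)) => //.
  - nra.
  - exact: norm_unit_le1.
  - by move=> y; have [] := fs [::].
  - by move=> y yK; have := fM y yK; rewrite pderivE word_unit.
pose z k (x : E) : E := \row_j (if (j < k)%N then x ord0 j else 0).
have zS k (kd : (k < d)%N) x :
  z k.+1 x = z k x + x ord0 (Ordinal kd) *: delta_mx ord0 (Ordinal kd).
  apply/rowP => j; rewrite !mxE ltnS eqxx /=.
  case: (ltngtP j k) => jk.
  - by rewrite -val_eqE /= ltn_eqF// mulr0 addr0.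
  - by rewrite -val_eqE /= gtn_eqF// mulr0 addr0.
  - by rewrite -val_eqE /= jk eqxx mulr1 add0r; congr (x _ _); exact: val_inj.
have zle k x : `|z k x| <= `|x|.
  rewrite [leLHS]/Num.norm /= mx_normrE; apply/bigmax_leP.
  split=> [|[a j] _ /=]; first exact: normr_ge0.
  by rewrite mxE; case: ifP => _; rewrite ?normr0 ?normr_ge0 ?coord_le_norm.
have chain k : (k <= d)%N -> forall n',
    holds_at u (fun f r => forall x, `|x| <= K -> `|f (z k x) - f 0| <= r ^+ n').
  elim: k => [_ n'|k IH kd n'].
    have := rho_small u ltr01; apply: irel_mono => e /andP[r0 _] x _.
    have -> : z 0%N x = 0 by apply/rowP => j; rewrite !mxE.
    by rewrite subrr normr0 exprn_ge0// ltW.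
  have i2 : 0 < 2^-1 :> R by rewrite invr_gt0.
  have := IH (ltnW kd) n'.+1; have := step (Ordinal kd) n'.+1.
  have := rho_small u i2; apply: irel_mono3 => -[f [r []]] /= /andP[r0 r2] st zk x xK.
  apply: le_trans (small_power n' r0 (c := 2) _); last by lra.
  rewrite -[X in `|X|](subrKA (f (z k x))) (le_trans (ler_normD _ _))//.
  rewrite mulr_natl mulr2n lerD//; last exact: zk.
  rewrite zS; apply: st; rewrite -?zS.
  - exact: le_trans (zle _ _) xK.
  - exact: le_trans (zle _ _) xK.
  - exact: le_trans (coord_le_norm _ _) xK.
have := chain d (leqnn d) n; apply: irel_mono => e H x xK.
have <- : z d x = x by apply/rowP => j; rewrite !mxE ltn_ord.
exact: H.
Qed.

(** Induction on the order of the derivative: if [w = pderiv a1 (f - f(0))] is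
    negligible then so is its derivative in the direction of the first letter of
    [a], by [landau]; the second derivative in that direction is moderate. *)
Lemma negligible_derivatives u : EModerate rho u ->
  negligible_op (fun f x => f x - f 0) u ->
  forall a, negligible_op (fun f => pderiv a (fun x => f x - f 0)) u.
Proof.
move=> um u0 a; have [k] := ubnP (size (word a)); elim: k a => // k IH a ak K n.
have [w0|wn0] := eqVneq (word a) [::].
  by apply: irel_mono (u0 K n) => e H x xK; rewrite pderivE w0; exact: H.
have [i [s [wa [a1 wa1] [a2 wa2]]]] := word_cons wn0.
have [m um2] := EModerate_uniform a2 um (K + 1).
have a1k : (size (word a1) < k)%N by rewrite wa1; move: ak; rewrite wa.
have w1 := IH a1 a1k (K + 1) ((m + n).+1 + n).+1.
have c0 : 0 < 6^-1 :> R by rewrite invr_gt0.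
have := rho_small u c0; have := proj1 um.
rewrite /star_smooth (starp1E (e := (u, (rho, tt)) : env S ctx)).
move: um2 w1; apply: irel_mono4 => -[f [r []]] /= fM f1 fs /andP[r0 r6] x xK.
have gs : smooth (fun x => f x - f 0) by exact: smooth_subr_cst.
rewrite pderivE wa /=; rewrite pderivE wa1 in f1.
have wa2n : word a2 != [::] by rewrite wa2.
rewrite -(pderiv_subr_cst _ (f 0) wa2n) pderivE wa2 /= in fM.
apply: (@landau R 'rV[R]_d K r n m (foldr (@partial R d) (fun x => f x - f 0) s)
  (delta_mx ord0 i)) xK => //.
- lra.
- lra.
- exact: norm_unit_le1.
- by move=> y; have [_] := gs s; apply.
- by move=> y; have [_] := gs (i :: s); apply.
Qed.

Lemma sub_self (f : E -> C) : (fun x => f x - f x) = fun=> 0.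
Proof. by apply/funext => x; rewrite subrr. Qed.

Lemma ENegligible_refl (u : S (E -> C)) : ENegligible rho (sdiff u u).
Proof.
split.
  rewrite /star_smooth /sdiff (starp1E (e := (u, (rho, tt)) : env S ctx)).
  by apply: irel_true => e; rewrite sub_self; exact: smooth_cst0.
move=> x a _ n; pose e := (x, (u, (rho, tt))) : env S ((E : Type) :: ctx).
rewrite /sdiff (negligibly_closeE (e := e)).
have := rho_small u ltr01; rewrite /holds_at -(irel_varS _ x).
apply: irel_mono => -[y [f [r []]]] /= /andP[r0 _].
by rewrite sub_self pderivE foldr_partial_cst0 subrr normr0 exprn_ge0// ltW.
Qed.

Lemma negligible_constant (u : S (E -> C)) : star_smooth u ->
  (forall a, negligible_op (fun f => pderiv a (fun x => f x - f 0)) u) ->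
  ENegligible rho (sdiff u (sconst _ (sapp u (emb S 0)))).
Proof.
move=> us un; split.
  move: us; rewrite /star_smooth /sdiff /sconst.
  rewrite !(starp1E (e := (u, (rho, tt)) : env S ctx)).
  by apply: irel_mono => e; exact: smooth_subr_cst.
move=> x a xns n; have [K xK] := near_standard_star_ball xns.
pose e := (x, (u, (rho, tt))) : env S ((E : Type) :: ctx).
rewrite /sdiff /sconst (negligibly_closeE (e := e)).
have := un a K n; rewrite /holds_at (irel_ball _ (fun e : env std ((E : Type) :: ctx) =>
  `|pderiv a (fun x => e.2.1 x - e.2.1 0) e.1| <= e.2.2.1 ^+ n)).
by move=> /(_ x xK); apply: irel_mono => -[y [f [r []]]] /=; rewrite subr0.
Qed.

End Constancy.

Theorem mainTheorem7 (S : nonstandard_extension) (R : realType) (rho : S R)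
    (hrho : positive_infinitesimal rho)
    (d : nat) (hd : (1 <= d)%N)
    (f : set (S ('rV[R]_d -> Rcomplex R))) (hf : rhoE rho f)
    (hinv : forall h : 'rV[R]_d, translate rho h f = f) :
  is_constant rho f.
Proof.
have [u um fE] := hf.
have fu : f u by rewrite -fE; split=> //; exact: ENegligible_refl.
exists u => //; apply: negligible_constant => //; first exact: proj1 um.
apply: negligible_derivatives => //; apply: negligible_increment => //.
exact: (invariant_negligible hrho fu).
Qed.
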